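(* For $x\in\mathbb{R}$, $n\in\{0,1,2,\ldots\}$ and real $\kappa>0$, $$\mathrm{Mi}_{-\kappa-n,\,\kappa-1/2}(x)=(-1)^{-\mathrm{sign}(x)\,\kappa}\,2^{\kappa}\sum_{m=0}^{n}\binom{n}{m}\frac{(-2)^m}{(2\kappa)_m}\,\gamma\left(\kappa+m,\,-x/2\right).$$
   Context: The Whittaker function is $\mathrm{M}_{\kappa,\mu}(x)=x^{\mu+1/2}e^{-x/2}\,{}_1F_1\!\left(\tfrac12+\mu-\kappa;\,1+2\mu;\,x\right)$, $2\mu\neq-1,-2,\ldots$, and the integral Whittaker function is $\mathrm{Mi}_{\kappa,\mu}(x)=\int_0^x\frac{\mathrm{M}_{\kappa,\mu}(t)}{t}dt$. $\gamma(\nu,z)=\int_0^zt^{\nu-1}e^{-t}dt$ is the lower incomplete gamma function and $(a)_m=a(a+1)\cdots(a+m-1)$ the Pochhammer symbol. Powers of negative numbers are taken with the principal branch, so $(-1)^{\alpha}=e^{i\pi\alpha}$ and $t^{\alpha}=|t|^{\alpha}e^{i\pi\alpha}$ for $t<0$; integrals with a negative endpoint are along the real segment. *)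

(* Defs.v *)
(* MathComp / MathComp-Analysis, over an arbitrary [R : realType]; complex
   numbers are [R[i]]. *)
From HB Require Import structures.
From mathcomp Require Import all_boot all_order all_algebra.
From mathcomp Require Import all_classical all_reals all_analysis.
From mathcomp Require Import complex.

Set Implicit Arguments.
Unset Strict Implicit.
Unset Printing Implicit Defensive.

Import Order.TTheory GRing.Theory Num.Theory.
Import numFieldNormedType.Exports.

Local Open Scope classical_set_scope.
Local Open Scope ring_scope.
Local Open Scope complex_scope.

Definition cis (R : realType) (theta : R) : R[i] := cos theta +i* sin theta.

(* Principal power of a real base with a real exponent: [t = |t| e^(i pi)] for
   [t < 0].  At [t = 0] it is [0 `^ a], i.e. [0] unless [a = 0]. *)
Definition ppow (R : realType) (t a : R) : R[i] :=
  if t < 0 then (`|t| `^ a)%:C * cis (pi * a) else (t `^ a)%:C.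

Definition pochhammer (F : pzRingType) (a : F) (m : nat) : F :=
  \prod_(i < m) (a + i%:R).

Definition hyp1F1 (R : realType) (a b x : R) : R :=
  lim ([series pochhammer a k / pochhammer b k * x ^+ k / k`!%:R]_k @ \oo).

Definition cintegral (R : realType) (D : set R) (f : R -> R[i]) : R[i] :=
  (\int[lebesgue_measure]_(t in D) complex.Re (f t)) +i*
  (\int[lebesgue_measure]_(t in D) complex.Im (f t)).

(* The integral from [0] to [x] along the real segment, oriented, so that the
   sign changes when [x < 0].  The Lebesgue integral also covers integrands
   with an absolutely integrable singularity at [0]. *)
Definition cintegral0 (R : realType) (f : R -> R[i]) (x : R) : R[i] :=
  if 0 <= x then cintegral `[0, x] f else - cintegral `[x, 0] f.

Definition whittakerM (R : realType) (kappa mu x : R) : R[i] :=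
  ppow x (mu + 1 / 2) * (expR (- x / 2))%:C *
  (hyp1F1 (1 / 2 + mu - kappa) (1 + 2 * mu) x)%:C.

Definition whittakerMi (R : realType) (kappa mu x : R) : R[i] :=
  cintegral0 (fun t => whittakerM kappa mu t / t%:C) x.

Definition lower_gamma (R : realType) (nu z : R) : R[i] :=
  cintegral0 (fun t => ppow t (nu - 1) * (expR (- t))%:C) z.

(* Main.v *)
(* By Kummer's transformation the series 1F1(2k+n; 2k; t) equals e^t times the
   polynomial sum_m C(n,m) t^m / (2k)_m, so the integrand of Mi is a linear
   combination of |t|^(k+m-1) e^(t/2).  Substituting t = -2u turns the m-th
   integral into 2^(k+m) times an incomplete gamma integral, and the phases of
   the principal powers on the two half-lines combine to (-1)^(-sign(x) k). *)
Require Import Defs.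
From HB Require Import structures.
From mathcomp Require Import all_boot all_order all_algebra.
From mathcomp Require Import all_classical all_reals all_analysis.
From mathcomp Require Import measurable_realfun complex.
From mathcomp Require Import ring.

Import Order.TTheory GRing.Theory Num.Theory.
Import numFieldNormedType.Exports.

Local Open Scope ring_scope.
Local Open Scope complex_scope.

(** * Pochhammer symbols and Chu-Vandermonde *)

Lemma pochhammer0 (F : pzRingType) (a : F) : pochhammer a 0 = 1.
Proof. by rewrite /pochhammer big_ord0. Qed.

Lemma pochhammerSr (F : pzRingType) (a : F) (m : nat) :
  pochhammer a m.+1 = pochhammer a m * (a + m%:R).
Proof. by rewrite /pochhammer big_ord_recr. Qed.

Lemma pochhammerS (F : pzRingType) (a : F) (m : nat) :
  pochhammer a m.+1 = a * pochhammer (a + 1) m.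
Proof.
rewrite /pochhammer big_ord_recl addr0; congr (_ * _); apply: eq_bigr => i _.
by rewrite /= /bump leq0n add1n -addrA nat1r.
Qed.

Lemma pochhammer_gt0 (F : numDomainType) (a : F) (m : nat) :
  0 < a -> 0 < pochhammer a m.
Proof. by move=> a0; apply: prodr_gt0 => i _; rewrite ltr_pwDl. Qed.

(* Chu-Vandermonde, in the form that makes 1F1(b+n; b; x) a finite combination
   of shifted exponential series. *)
Lemma pochhammer_addn (F : numFieldType) (n : nat) (b : F) (k : nat) : 0 < b ->
  pochhammer (b + n%:R) k =
  pochhammer b k *
  \sum_(m < n.+1) 'C(n, m)%:R / pochhammer b m * (k ^_ m)%:R.
Proof.
elim: n b k => [|n IHn] b k b0.
  by rewrite big_ord1 bin0 ffactn0 pochhammer0 addr0 divr1 !mulr1.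
have bn0 : b != 0 by rewrite gt_eqF.
pose S b k := \sum_(m < n.+1) 'C(n, m)%:R / pochhammer b m * (k ^_ m)%:R : F.
(* Pascal's rule splits the sum. In the shifted half, one factor of each of [k ^_ m.+1] and
   [pochhammer b m.+1] comes out, leaving the same sum at [b + 1] and [k.-1]; hence the induction
   over all [b] and [k]. *)
have -> : \sum_(m < n.+2) 'C(n.+1, m)%:R / pochhammer b m * (k ^_ m)%:R =
          S b k + k%:R / b * S (b + 1) k.-1.
  rewrite big_ord_recl /=.
  under eq_bigr => i _ do rewrite /bump leq0n add1n binS natrD 2!mulrDl.
  rewrite big_split /= addrA; congr (_ + _).
    rewrite big_ord_recr /= (bin_small (ltnSn n)) !mul0r addr0.
    rewrite /S big_ord_recl !bin0; congr (_ + _).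
  rewrite /S mulr_sumr; apply: eq_bigr => i _.
  rewrite ffactnS natrM pochhammerS invfM; ring.
have SE c j : 0 < c -> pochhammer c j * S c j = pochhammer (c + n%:R) j.
  by move=> c0; rewrite IHn.
(* At [k = 0] the truncated [k.-1] is harmless, since its term carries the factor [k%:R]. *)
rewrite mulrDr SE //; case: k => [|k].
  by rewrite !pochhammer0 !mul0r mulr0 addr0.
rewrite [pochhammer b _]pochhammerS /=.
have -> : b * pochhammer (b + 1) k * (k.+1%:R / b * S (b + 1) k) =
          k.+1%:R * pochhammer (b + 1 + n%:R) k.
  by rewrite -SE ?ltr_wpDr //; field.
have -> : b + n.+1%:R = b + 1 + n%:R by rewrite -nat1r addrA.
have bE : b + n%:R + 1 = b + 1 + n%:R by rewrite addrAC.
rewrite pochhammerSr pochhammerS bE -!nat1r; ring.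
Qed.

(** * Kummer's transformation in the polynomial case *)

Section kummer.
Local Open Scope classical_set_scope.
Context (R : realType).
Implicit Types x b : R.

(** The first [m] terms vanish and [k ^_ m / k!] is [1 / (k - m)!] afterwards, so this is the
    exponential series shifted by [m]. Each induction step drops the zero term at [k = 0] and pulls
    out one [x]. *)
Lemma cvg_series_ffact_expR (m : nat) x :
  [series (k ^_ m)%:R * (x ^+ k / k`!%:R)]_k @ \oo --> x ^+ m * expR x.
Proof.
elim: m => [|m IHm].
  rewrite mul1r (_ : (fun k => _) = exp_coeff x).
    exact: is_cvg_series_exp_coeff.
  by apply/funext => k; rewrite ffactn0 mul1r.
rewrite -cvg_shiftS exprS -mulrA.
have -> : [sequence series (fun k => (k ^_ m.+1)%:R * (x ^+ k / k`!%:R)) n.+1]_n =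
    (fun n => x * series (fun k => (k ^_ m)%:R * (x ^+ k / k`!%:R)) n).
  apply/funext => n; rewrite /series /= big_nat_recl // mul0r add0r mulr_sumr.
  apply: eq_bigr => k _; rewrite ffactnS natrM exprS factS natrM invfM /=.
  have k0 : k.+1%:R != 0 :> R by rewrite pnatr_eq0.
  have f0 : k`!%:R != 0 :> R by rewrite pnatr_eq0 -lt0n fact_gt0.
  by move: (k.+1%:R : R) k0 => a a0; field; rewrite a0 f0.
exact: cvgMl_tmp.
Qed.

(** Chu-Vandermonde is applied inside the partial sums, where exchanging two finite sums is free;
    the limit then passes through a sum of [n.+1] series. *)
Lemma hyp1F1_addn (n : nat) b x : 0 < b ->
  hyp1F1 (b + n%:R) b x =
  expR x * \sum_(m < n.+1) 'C(n, m)%:R / pochhammer b m * x ^+ m.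
Proof.
move=> b0; rewrite /hyp1F1 mulr_sumr.
have -> : series (fun k =>
      pochhammer (b + n%:R) k / pochhammer b k * x ^+ k / k`!%:R) =
    (fun N => \sum_(m < n.+1) 'C(n, m)%:R / pochhammer b m *
       series (fun k => (k ^_ m)%:R * (x ^+ k / k`!%:R)) N).
  apply/funext => N; rewrite /series /=.
  under [RHS]eq_bigr do rewrite mulr_sumr.
  rewrite exchange_big /=; apply: eq_bigr => k _.
  rewrite pochhammer_addn // [X in X * _ / _]mulrAC mulfV; last first.
    by rewrite gt_eqF // pochhammer_gt0.
  by rewrite mul1r -mulrA mulr_suml; apply: eq_bigr => m _; rewrite -!mulrA.
apply/cvg_lim => //; apply: cvg_big => [|m _].
  by move=> z; exact: add_continuous.
rewrite (_ : expR x * _ = 'C(n, m)%:R / pochhammer b m * (x ^+ m * expR x)).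
  by apply: cvgMl_tmp; exact: cvg_series_ffact_expR.
by rewrite mulrC mulrA.
Qed.
End kummer.

(** * Lebesgue measure under scaling, and integrability at the singularity *)

Section scaling.
Local Open Scope classical_set_scope.
Context (R : realType).
Notation mu := (@lebesgue_measure R).
Local Open Scope ereal_scope.

Lemma mulr_preimage_itvoc (c a b : R) : c != 0%R ->
  *%R c @^-1` `]a, b] =
  if (0 < c)%R then `](c^-1 * a)%R, (c^-1 * b)%R]%classic
  else `[(c^-1 * b)%R, (c^-1 * a)%R[%classic.
Proof.
move=> c0; case: ifPn => [cp|cn]; apply/seteqP; split => t /=; rewrite !in_itv/=.
- by rewrite ler_pdivlMl // ltr_pdivrMl.
- by rewrite ler_pdivlMl // ltr_pdivrMl.
- rewrite -leNgt le_eqVlt (negPf c0) /= in cn.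
  by rewrite ler_ndivrMl // ltr_ndivlMl // andbC.
- rewrite -leNgt le_eqVlt (negPf c0) /= in cn.
  by rewrite ler_ndivrMl // ltr_ndivlMl // andbC.
Qed.

(** Lebesgue measure is determined by its values on the intervals []a, b]]. A negative [c] moves the
    closed end to the other side, which leaves the length unchanged. *)
Lemma lebesgue_measureM (c : R) (A : set (measurableTypeR R)) : c != 0%R ->
  measurable A ->
  mu A = `|c|%R%:E * pushforward mu ( *%R c : _ -> measurableTypeR R) A.
Proof.
move=> c0 mA.
have mc : measurable_fun setT ( *%R c : measurableTypeR R -> measurableTypeR R).
  exact: mulrl_measurable.
apply: (lebesgue_measure_unique (mu := mscale (NngNum (normr_ge0 c))
  (pushforward mu ( *%R c : _ -> measurableTypeR R)))) => // _ [[a b] /= _ <-].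
rewrite /mscale /= /pushforward mulr_preimage_itvoc // (fun_if mu).
rewrite !lebesgue_measure_itv /= !lte_fin.
case: (boolP (0 < c)%R) => cp.
  have ci : (0 < c^-1)%R by rewrite invr_gt0.
  rewrite ltr_pM2l //; case: ifPn => ab; last by rewrite mule0.
  by rewrite -EFinD -EFinM gtr0_norm // -mulrBr mulVKf.
have {}cp : (c < 0)%R by rewrite -leNgt le_eqVlt (negPf c0) /= in cp.
have ci : (c^-1 < 0)%R by rewrite invr_lt0.
rewrite ltr_nM2l //; case: ifPn => ab; last by rewrite mule0.
by rewrite -EFinD -EFinM ltr0_norm // -mulrBr mulNr mulVKf // opprB.
Qed.

(** Change of variables for either sign of [c]: [c = -1] will give the reflection of a half-line and
    [c = 2] the rescaling of the gamma integral. *)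
Lemma ge0_integral_mulr (c : R) (D : set R) (f : R -> \bar R) : c != 0%R ->
  measurable D -> measurable_fun D f -> (forall t, D t -> 0 <= f t) ->
  \int[mu]_(t in D) f t =
  `|c|%R%:E * \int[mu]_(t in *%R c @^-1` D) f (c * t)%R.
Proof.
move=> c0 mD mf f0.
have mc : measurable_fun setT ( *%R c : measurableTypeR R -> measurableTypeR R).
  exact: mulrl_measurable.
rewrite -(ge0_integral_pushforward mc mu mD mf) //; last first.
  by move=> t /[!inE] Dt; exact: f0.
rewrite -(ge0_integral_mscale (pushforward mu ( *%R c : _ -> measurableTypeR R))
  mD (NngNum (normr_ge0 c)) mf) //.
apply: eq_measure_integral => A mA AD; exact: lebesgue_measureM.
Qed.

Lemma itvoc_bigcup (y : R) : `]0%R, y] = \bigcup_n `[n.+1%:R^-1%R, y] :> set R.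
Proof.
apply/seteqP; split => [t /=|t [n _] /=]; rewrite !in_itv /= => /andP[t0 ty].
  (* This index satisfies [t^-1 < n.+1], so [n.+1%:R^-1] lies below [t]. *)
  exists (Num.truncn t^-1) => //=; rewrite in_itv /= ty andbT.
  by rewrite invf_ple ?posrE ?ltr0n // ltW // truncnS_gt.
by rewrite ty andbT (lt_le_trans _ t0) // invr_gt0.
Qed.

(* The bound is uniform in [e], which handles the singularity at [0] for [a < 1]. *)
Lemma integral_powR_le (a e y : R) : (0 < a)%R -> (0 < e)%R -> (e <= y)%R ->
  \int[mu]_(t in `[e, y]) (t `^ (a - 1))%:E <= (y `^ a / a)%:E.
Proof.
move=> a0 e0; rewrite le_eqVlt => /predU1P[<-|ey].
  by rewrite set_itv1 integral_set1 lee_fin divr_ge0 ?powR_ge0 // ltW.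
have dF (t : R) : (0 < t)%R ->
    is_derive t 1%R (fun s => s `^ a / a)%R (t `^ (a - 1))%R.
  move=> t0.
  have -> : (fun s => s `^ a / a)%R = (a^-1 *: (@powR R ^~ a))%R.
    by apply/funext => s; rewrite /= mulrC.
  have := @is_deriveZ R R R (@powR R ^~ a) a^-1%R t 1%R _ (@is_derive1_powR R a t t0).
  by rewrite /GRing.scale /= mulKf // gt_eqF.
have ct (b t : R) : (0 < t)%R -> {for t, continuous (fun s => s `^ b)%R}.
  move=> t0; apply: differentiable_continuous; apply/derivable1_diffP.
  by apply: derivable_powR; rewrite in_itv /= andbT.
have y0 := lt_trans e0 ey.
rewrite (@continuous_FTC2 _ _ (fun s => s `^ a / a)%R) //.
- by rewrite lee_fin lerBlDr lerDl divr_ge0 ?powR_ge0 // ltW.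
- apply: continuous_in_subspaceT => t /[!inE] /= /[!in_itv] /= /andP[et _].
  by apply: ct; exact: lt_le_trans et.
- split.
  + by move=> t; rewrite in_itv /= => /andP[et _]; apply: ex_derive; apply: dF; exact: lt_trans et.
  + by apply: cvg_at_right_filter; apply: cvgM; [exact: ct|exact: cvg_cst].
  + by apply: cvg_at_left_filter; apply: cvgM; [exact: ct|exact: cvg_cst].
- move=> t; rewrite in_itv /= => /andP[et _].
  by rewrite derive1E; apply: derive_val; apply: dF; exact: lt_trans et.
Qed.

(** The exponential is bounded on the segment, so only the power matters; its integral is bounded by
    monotone convergence along [[1/(n+1), y]]. *)
Lemma integrable_powR_expR (a c y : R) : (0 < a)%R ->
  mu.-integrable `[0%R, y] (fun t => (t `^ (a - 1) * expR (c * t))%:E).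
Proof.
move=> a0.
have mp D : measurable_fun D (fun t : R => t `^ (a - 1))%R.
  by apply: measurable_funTS; exact: measurable_powR.
suff ip : mu.-integrable `[0%R, y] (fun t => (t `^ (a - 1))%:E).
  apply: (@integrableMl _ _ _ mu _ _ (EFin \o _) (fun t => expR (c * t))%R) => //.
    by apply: measurable_funTS; apply: measurableT_comp => //; exact: mulrl_measurable.
  exists (expR (`|c| * y)); split; first exact: num_real.
  move=> M yM t /=; rewrite in_itv /= => /andP[t0 ty].
  rewrite gtr0_norm ?expR_gt0 // (le_trans _ (ltW yM)) // ler_expR.
  apply: (@le_trans _ _ (`|c| * t)%R); first by rewrite ler_wpM2r ?ler_norm //.
  by rewrite ler_wpM2l.
apply/integrableP; split; first by apply/measurable_EFinP; exact: mp.
under eq_integral do rewrite gee0_abs ?lee_fin ?powR_ge0 //.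
rewrite -integral_itv_obnd_cbnd; last by apply/measurable_EFinP; exact: mp.
rewrite itvoc_bigcup; set F := fun n => `[n.+1%:R^-1%R, y]%classic.
have cv : \int[mu]_(t in F n) (t `^ (a - 1))%:E @[n --> \oo] -->
          \int[mu]_(t in \bigcup_n F n) (t `^ (a - 1))%:E.
  apply: ge0_nondecreasing_set_cvg_integral => [m n mn||n|n t _].
  - apply/subsetPset => t; rewrite /F /= !in_itv /= => /andP[mt ->].
    by rewrite andbT (le_trans _ mt) // lef_pV2 ?posrE ?ltr0n // ler_nat ltnS.
  - by move=> i; rewrite /F; exact: measurable_itv.
  - by apply/measurable_EFinP; exact: mp.
  - by rewrite lee_fin powR_ge0.
apply: (@le_lt_trans _ _ (y `^ a / a)%:E); last exact: ltry.
rewrite -(cvg_lim _ cv) //; apply: lime_le; first exact/cvgP/cv.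
(* When [1/(n+1)] exceeds [y] the interval is empty and the bound is trivial. *)
apply: nearW => n; have [ny|yn] := leP (n.+1%:R^-1)%R y.
  exact: integral_powR_le.
rewrite /F set_itv_ge ?integral_set0 ?lee_fin ?divr_ge0 ?powR_ge0 // ?ltW //.
by rewrite bnd_simp -ltNge.
Qed.
End scaling.

(** * Change of variables for real-valued integrals *)

Section Rintegral_scaling.
Local Open Scope classical_set_scope.
Context (R : realType).
Notation mu := (@lebesgue_measure R).

Lemma measurable_preimage_mulr (c : R) (D : set R) :
  measurable D -> measurable ( *%R c @^-1` D).
Proof. by move=> mD; rewrite -[X in measurable X]setTI; exact: mulrl_measurable. Qed.

Lemma measurable_fun_mulr (c : R) (D : set R) (f : R -> R) : measurable D ->
  measurable_fun D f -> measurable_fun ( *%R c @^-1` D) (fun t => f (c * t)).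
Proof.
by move=> mD mf; apply: (measurable_comp mD) => // _ [t Dt <-].
Qed.

Lemma integrable_mulr (c : R) (D : set R) (f : R -> R) : c != 0 ->
  measurable D -> mu.-integrable D (EFin \o f) ->
  mu.-integrable ( *%R c @^-1` D) (fun t => (f (c * t))%:E).
Proof.
move=> c0 mD /integrableP[/measurable_EFinP mf intf]; apply/integrableP; split.
  by apply/measurable_EFinP; exact: measurable_fun_mulr.
move: intf; rewrite (ge0_integral_mulr _ _ _ (fun t => `|(f t)%:E|%E) c0 mD) //; last first.
  by apply: measurableT_comp => //; exact/measurable_EFinP.
(* Were the rescaled integral infinite, multiplying it by [|c| > 0] would leave it infinite. *)
rewrite ![(_ < +oo)%E]ltey; apply: contra_neq => ->.
by rewrite gt0_muley // lte_fin normr_gt0.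
Qed.

Lemma Rintegral_mulr (c : R) (D : set R) (f : R -> R) : c != 0 ->
  measurable D -> mu.-integrable D (EFin \o f) ->
  \int[mu]_(t in D) f t = `|c| * \int[mu]_(t in *%R c @^-1` D) f (c * t).
Proof.
move=> c0 mD intf; have intfc := integrable_mulr c D f c0 mD intf.
have mf := measurable_int _ intf.
rewrite /Rintegral -[X in X * _]/(fine `|c|%:E) -fineM //; last first.
  by apply: integrable_fin_num => //; exact: measurable_preimage_mulr.
congr fine; rewrite integralE [in RHS]integralE.
rewrite (ge0_integral_mulr _ _ _ _ c0 mD) //; last exact: measurable_funepos.
rewrite (ge0_integral_mulr _ _ _ (EFin \o f)^\-%E c0 mD) //; last exact: measurable_funeneg.
have pE := funepos_comp (EFin \o f) ( *%R c).
have nE := funeneg_comp (EFin \o f) ( *%R c).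
(* Finiteness of the negative part lets [|c|] distribute over the extended-real difference. *)
have : (\int[mu]_(t in *%R c @^-1` D) ((EFin \o f) \o *%R c)^\- t \is a fin_num)%E.
  by apply: integrable_neg_fin_num => //; exact: measurable_preimage_mulr.
rewrite pE nE => nfin; rewrite [RHS]muleBr //; apply: fin_num_adde_defl.
by rewrite fin_numN.
Qed.

End Rintegral_scaling.

(** * Integrals of finite linear combinations *)

Section lincomb.
Local Open Scope classical_set_scope.
Context d (T : measurableType d) (R : realType).
Context (mu : {measure set T -> \bar R}) (n : nat) (g : 'I_n -> T -> R).

Let EFin_lincomb (v : 'I_n -> R) : (fun t => (\sum_m v m * g m t)%:E) =
  (fun t => \sum_m ((v m)%:E * (EFin \o g m) t))%E.
Proof. by apply/funext => t; rewrite -sumEFin. Qed.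

Lemma integrable_lincomb (D : set T) (v : 'I_n -> R) : measurable D ->
  (forall m, mu.-integrable D (EFin \o g m)) ->
  mu.-integrable D (fun t => (\sum_m v m * g m t)%:E).
Proof.
move=> mD ig; rewrite EFin_lincomb.
by apply: integrable_sum => // m _; exact: integrableZl.
Qed.

Lemma Rintegral_lincomb (D : set T) (v : 'I_n -> R) : measurable D ->
  (forall m, mu.-integrable D (EFin \o g m)) ->
  \int[mu]_(t in D) (\sum_m v m * g m t) = \sum_m v m * \int[mu]_(t in D) g m t.
Proof.
move=> mD ig; have iZ m := integrableZl mD (v m) (ig m).
rewrite /Rintegral EFin_lincomb integral_sum // -sum_fine; last first.
  by move=> m _; apply: integrable_fin_num => //; exact: iZ.
apply: eq_bigr => m _; rewrite integralZl // fineM //.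
exact: integrable_fin_num.
Qed.

End lincomb.

(** * Oriented complex integrals reduced to real ones on [[0, |x|]] *)

Section segment_integrals.
Local Open Scope classical_set_scope.
Context (R : realType).
Notation mu := (@lebesgue_measure R).

Lemma sum_complexM_real n (w : 'I_n -> R[i]) (r : 'I_n -> R) :
  \sum_m w m * (r m)%:C =
  (\sum_m complex.Re (w m) * r m) +i* (\sum_m complex.Im (w m) * r m).
Proof.
elim/big_rec3: _ => [//|m a b c _ ->].
by case: (w m) => u v /=; congr (_ +i* _); rewrite ?mulr0 ?subr0 ?add0r.
Qed.

Section segment.
Context (n : nat) (g : 'I_n -> R -> R) (x : R).
Context (ig : forall m, mu.-integrable `[0, `|x|] (EFin \o g m)).

(** The formula for [h] is assumed only away from [0], so the work is done on []0, |x|]]; adding the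
    endpoint back to the [g m] costs nothing, as it is a null set. *)
Let Rintegral_itvoc_lincomb (v : 'I_n -> R) (h : R -> R) :
  (forall t, 0 < t <= `|x| -> h t = \sum_m v m * g m t) ->
  mu.-integrable `]0, `|x|] (EFin \o h) /\
  \int[mu]_(t in `]0, `|x|]) h t = \sum_m v m * \int[mu]_(t in `[0, `|x|]) g m t.
Proof.
move=> hE; have igo m : mu.-integrable `]0, `|x|] (EFin \o g m).
  apply: (@integrableS _ _ R mu `[0, `|x|]) => //.
  by apply: subset_itv_oc_cc.
have hEs : {in `]0, `|x|]%classic, h =1 (fun t => \sum_m v m * g m t)}.
  by move=> t; rewrite inE /= in_itv /=; exact: hE.
split.
  apply: (@eq_integrable _ _ R mu _ (measurable_itv _)
    (fun t => (\sum_m v m * g m t)%:E)); last exact: integrable_lincomb.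
  by move=> t /hEs /= ->.
transitivity (\int[mu]_(t in `]0, `|x|]) (\sum_m v m * g m t)).
  exact: eq_Rintegral.
rewrite Rintegral_lincomb //.
by apply: eq_bigr => m _; rewrite Rintegral_itv_obnd_cbnd.
Qed.

Let mulN1_preimage_itv : *%R (-1) @^-1` `]0, `|x|] = `[- `|x|, 0[%classic.
Proof.
by apply/seteqP; split => t /=; rewrite !in_itv /= mulN1r oppr_gt0 lerNl andbC.
Qed.

(** For [x < 0] the reflection [t -> - t] carries the segment onto [[0, |x|]]. This integral is
    unoriented, so no sign of [x] appears in the value. *)
Lemma Rintegral_segment_lincomb (v : 'I_n -> R) (h : R -> R) : x != 0 ->
  (forall t, 0 < t <= `|x| -> h (Num.sg x * t) = \sum_m v m * g m t) ->
  \int[mu]_(t in if 0 <= x then `[0, x] else `[x, 0]) h t =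
  \sum_m v m * \int[mu]_(t in `[0, `|x|]) g m t.
Proof.
move=> x0 hE; case: ifPn => [xge0|].
  have xgt0 : 0 < x by rewrite lt_neqAle eq_sym x0.
  have [|ih <-] := @Rintegral_itvoc_lincomb v h.
    by move=> t /hE <-; rewrite gtr0_sg // mul1r.
  by rewrite gtr0_norm // Rintegral_itv_obnd_cbnd // -[X in `]0, X]]gtr0_norm.
rewrite -ltNge => xlt0.
have [|ih <-] := @Rintegral_itvoc_lincomb v (fun t => h (- t)).
  by move=> t /hE <-; rewrite ltr0_sg // mulN1r.
have N1 : -1 != 0 :> R by rewrite oppr_eq0 oner_eq0.
have hN : (fun t => h (- (-1 * t))) = h.
  by apply/funext => t; rewrite mulN1r opprK.
have ihN := integrable_mulr _ _ _ _ N1 (measurable_itv _) ih.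
rewrite (Rintegral_mulr _ _ _ _ N1 (measurable_itv _) ih) hN.
rewrite -[X in mu.-integrable _ X]/(EFin \o (fun t => h (- (-1 * t)))) hN in ihN.
rewrite mulN1_preimage_itv ltr0_norm // opprK in ihN *.
by rewrite normrN1 mul1r Rintegral_itv_bndo_bndc.
Qed.

(* [f] is unconstrained at [0], where [t `^ 0], [ppow] and [_ / 0] take
   unrelated junk values. *)
Lemma cintegral0_lincomb (w : 'I_n -> R[i]) (f : R -> R[i]) : x != 0 ->
  (forall t, 0 < t <= `|x| -> f (Num.sg x * t) = \sum_m w m * (g m t)%:C) ->
  cintegral0 f x =
  (Num.sg x)%:C * \sum_m w m * (\int[mu]_(t in `[0, `|x|]) g m t)%:C.
Proof.
move=> x0 fE; rewrite sum_complexM_real.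
rewrite -(Rintegral_segment_lincomb (fun m => complex.Re (w m))
  (fun t => complex.Re (f t))) //; last first.
  by move=> t /fE ->; rewrite sum_complexM_real.
rewrite -(Rintegral_segment_lincomb (fun m => complex.Im (w m))
  (fun t => complex.Im (f t))) //; last first.
  by move=> t /fE ->; rewrite sum_complexM_real.
rewrite /cintegral0 /cintegral; case: ifPn => [xge0|].
  by rewrite gtr0_sg ?mul1r // lt_neqAle eq_sym x0.
by rewrite -ltNge => xlt0; rewrite ltr0_sg // rmorphN mulN1r.
Qed.

End segment.
End segment_integrals.

(** * Phases, and both special functions as real gamma integrals *)

Section evaluation.
Local Open Scope classical_set_scope.
Context (R : realType).
Notation mu := (@lebesgue_measure R).
Implicit Types a b c t x y z kappa nu : R.

Lemma cisD a b : cis (a + b) = cis a * cis b.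
Proof. by rewrite /cis cosD sinD [X in _ +i* X]addrC. Qed.

Lemma cis0 : cis (0 : R) = 1.
Proof. by rewrite /cis cos0 sin0. Qed.

Lemma cispi : cis (pi : R) = -1.
Proof. by rewrite /cis cospi sinpi -[-1 +i* 0]/((-1)%:C) rmorphN1. Qed.

Lemma cis_pi_natr (m : nat) : cis (pi * m%:R : R) = (-1) ^+ m.
Proof.
elim: m => [|m IHm]; first by rewrite mulr0 cis0.
by rewrite -natr1 mulrDr mulr1 cisD IHm cispi exprSr.
Qed.

Lemma cis_piN a : cis (pi * - a) * cis (pi * a) = 1.
Proof. by rewrite -cisD -mulrDr addNr mulr0 cis0. Qed.

Lemma cis_pi_shift a (m : nat) :
  cis (pi * (a + m%:R - 1)) = - ((-1) ^+ m * cis (pi * a)).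
Proof.
(* Multiplying by [cis pi = -1] absorbs the [- 1] in the exponent. *)
have : cis (pi * (a + m%:R - 1)) * cis pi = (-1) ^+ m * cis (pi * a).
  by rewrite -cis_pi_natr mulrC -!cisD; congr cis; ring.
by rewrite cispi mulrN1 => <-; rewrite opprK.
Qed.

Lemma ppowN1 a : ppow (-1) a = cis (pi * a).
Proof. by rewrite /ppow oppr_lt0 ltr01 normrN1 powR1 mul1r. Qed.

(* The constant value of [ppow t a / `|t| `^ a] on the half-line of [x]. *)
Definition phase x a : R[i] := if 0 < x then 1 else cis (pi * a).

Lemma ppow_sgM x t a : x != 0 -> 0 < t ->
  ppow (Num.sg x * t) a = phase x a * (t `^ a)%:C.
Proof.
rewrite /phase /ppow => x0 t0; have [xgt0|xlt0|x0'] := ltrgtP 0 x.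
- by rewrite gtr0_sg // !mul1r ltNge ltW.
- by rewrite ltr0_sg // mulN1r oppr_lt0 t0 normrN gtr0_norm // mulrC.
- by rewrite -x0' eqxx in x0.
Qed.

(** Common real form of both sides. The rate [c] lets it cover incomplete gamma functions of
    positive argument ([c = -1]) and, up to phase, of negative argument ([c = 1]). *)
Definition gamma_int a c y : R :=
  \int[mu]_(t in `[0, y]) (t `^ (a - 1) * expR (c * t)).

(** Substitute [t = 2 u]: the Jacobian [2] and the factor [2]^ (a - 1)[combine to]2 [^ a]. *)
Lemma gamma_int_scale a c y : 0 < a ->
  gamma_int a (c / 2) y = 2 `^ a * gamma_int a c (y / 2).
Proof.
move=> a0; have n2 : 2 != 0 :> R by rewrite pnatr_eq0.
have pre : *%R 2 @^-1` `[0, y] = `[0, y / 2]%classic.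
  by apply/seteqP; split => t /=; rewrite !in_itv /= pmulr_rge0 // ler_pdivlMr // mulrC.
rewrite /gamma_int (Rintegral_mulr _ _ _ _ n2 (measurable_itv _)); last first.
  exact: integrable_powR_expR.
rewrite pre ger0_norm //.
transitivity (2 * \int[mu]_(t in `[0, y / 2]) (2 `^ (a - 1) * (t `^ (a - 1) * expR (c * t)))).
  congr (_ * _); apply: eq_Rintegral => t; rewrite inE /= in_itv /= => /andP[t0 _].
  by rewrite powRM // -mulrA; congr (_ * (_ * expR _)); field.
rewrite RintegralZl //; last exact: integrable_powR_expR.
by rewrite mulrA mulr_powRB1.
Qed.

(** One-term case of [cintegral0_lincomb]: the phase is constant along the segment, and the leading
    sign is its orientation. *)
Lemma lower_gammaE nu z : 0 < nu -> z != 0 ->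
  lower_gamma nu z =
  (Num.sg z)%:C * (phase z (nu - 1) * (gamma_int nu (- Num.sg z) `|z|)%:C).
Proof.
move=> nu0 z0; rewrite /lower_gamma.
rewrite (cintegral0_lincomb _ 1 (fun=> fun t => t `^ (nu - 1) * expR (- Num.sg z * t))
  z _ (fun=> phase z (nu - 1))) //.
- by rewrite big_ord1.
- by move=> _; exact: integrable_powR_expR.
- by move=> t /andP[t0 _]; rewrite big_ord1 ppow_sgM // rmorphM mulrA mulNr.
Qed.

Lemma whittakerM_negn kappa (n : nat) x : 0 < kappa ->
  whittakerM (- kappa - n%:R) (kappa - 1 / 2) x =
  ppow x kappa * (expR (x / 2) *
    \sum_(m < n.+1) 'C(n, m)%:R / pochhammer (2 * kappa) m * x ^+ m)%:C.
Proof.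
move=> k0; rewrite /whittakerM subrK.
have -> : 1 / 2 + (kappa - 1 / 2) - (- kappa - n%:R) = 2 * kappa + n%:R by ring.
have -> : 1 + 2 * (kappa - 1 / 2) = 2 * kappa by field.
rewrite hyp1F1_addn ?mulr_gt0 // -mulrA -rmorphM mulrA -expRD.
by congr (_ * (expR _ * _)%:C); field.
Qed.

(** The sign coming from the division by [t] cancels the orientation sign, so only the
    [Num.sg x ^+ m] from the polynomial survives. *)
Lemma whittakerMiE kappa (n : nat) x : 0 < kappa -> x != 0 ->
  whittakerMi (- kappa - n%:R) (kappa - 1 / 2) x =
  \sum_(m < n.+1) phase x kappa *
    (Num.sg x ^+ m * ('C(n, m)%:R / pochhammer (2 * kappa) m) *
     gamma_int (kappa + m%:R) (Num.sg x / 2) `|x|)%:C.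
Proof.
move=> k0 x0; rewrite /whittakerMi.
have ss : Num.sg x * Num.sg x = 1 by rewrite -expr2 sqr_sg x0.
have s0 : Num.sg x != 0 by rewrite sgr_eq0.
rewrite (cintegral0_lincomb _ n.+1
  (fun m t => t `^ (kappa + m%:R - 1) * expR (Num.sg x / 2 * t)) x _
  (fun m => phase x kappa *
    (Num.sg x * (Num.sg x ^+ m * ('C(n, m)%:R / pochhammer (2 * kappa) m)))%:C)) //.
- rewrite mulr_sumr; apply: eq_bigr => m _.
  rewrite -/(gamma_int _ _ _) -mulrA -rmorphM mulrCA -rmorphM; congr (_ * _%:C).
  by rewrite !mulrA ss mul1r.
- by move=> m; apply: integrable_powR_expR; rewrite ltr_wpDr.
- move=> t /andP[t0 _]; rewrite whittakerM_negn // ppow_sgM //.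
  (* The phase factors out, leaving a real identity in which [t]^ (kappa + m%:R - 1)[is split as]t
     [^ kappa * t ^+ m / t]. *)
  rewrite -mulrA -mulrA -fmorphV -!rmorphM /=.
  under [RHS]eq_bigr do rewrite -mulrA -rmorphM.
  rewrite -mulr_sumr -raddf_sum; congr (_ * _%:C).
  rewrite mulr_sumr mulr_suml mulr_sumr; apply: eq_bigr => m _.
  have -> : kappa + m%:R - 1 = kappa + (m%:R - 1) by rewrite addrA.
  have tn0 : t != 0 by rewrite gt_eqF.
  rewrite powRD ?tn0 ?implybT // powRB ?tn0 ?implybT // powR_mulrn ?(ltW t0) //.
  rewrite powRr1 ?(ltW t0) // exprMn invfM.
  have -> : (Num.sg x)^-1 = Num.sg x by apply: (mulfI s0); rewrite mulfV // ss.
  have -> : Num.sg x * t / 2 = Num.sg x / 2 * t by rewrite mulrAC.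
  ring.
Qed.

End evaluation.

Theorem theorem38 (R : realType) (x kappa : R) (n : nat) (hkappa : 0 < kappa) :
  whittakerMi (- kappa - n%:R) (kappa - 1 / 2) x =
  ppow (-1) (- (Num.sg x * kappa)) * ppow 2 kappa *
  \sum_(m < n.+1)
    'C(n, m)%:R * ((-2) ^+ m / pochhammer ((2 * kappa)%:C) m) *
    lower_gamma (kappa + m%:R) (- x / 2).
Proof.
(* At [x = 0] every integral is over a single point, so both sides vanish. *)
have [->|x0] := eqVneq x 0.
  have c0 (f : R -> R[i]) : cintegral0 f 0 = 0.
    by rewrite /cintegral0 lexx /cintegral set_itv1 !Rintegral_set1.
  rewrite /whittakerMi c0 big1 ?mulr0 // => m _.
  by rewrite oppr0 mul0r /lower_gamma c0 mulr0.
have pochC (m : nat) : pochhammer ((2 * kappa)%:C) m = (pochhammer (2 * kappa) m)%:C.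
  rewrite /pochhammer rmorph_prod; apply: eq_bigr => i _.
  by rewrite rmorphD rmorph_nat.
have z0 : - x / 2 != 0 by rewrite mulf_neq0 ?oppr_eq0 // invr_eq0 pnatr_eq0.
have sgz : Num.sg (- x / 2) = - Num.sg x.
  by rewrite sgrM sgrN [Num.sg 2^-1]gtr0_sg ?invr_gt0 // mulr1.
have nz : `|- x / 2| = `|x| / 2 by rewrite normrM normrN [`|2^-1|]gtr0_norm ?invr_gt0.
have pow2 : ppow 2 kappa = (2 `^ kappa)%:C by rewrite /ppow ltNge ler0n.
rewrite whittakerMiE // mulr_sumr; apply: eq_bigr => m _.
have km : 0 < kappa + m%:R by rewrite ltr_wpDr.
(* The argument [- x / 2] has sign opposite to [x], so both sides have exponential rate [Num.sg x]
   once the left side is rescaled to length [|x| / 2]. *)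
rewrite lower_gammaE // sgz nz opprK gamma_int_scale // pow2 pochC.
rewrite powRD ?pnatr_eq0 ?implybT // powR_mulrn //.
rewrite ppowN1 /phase.
have -> : (0 < - x / 2) = (x < 0) by rewrite pmulr_lgt0 ?invr_gt0 // oppr_gt0.
set J := gamma_int _ _ _ _; set P := pochhammer (2 * kappa) m.
have [xgt0|xlt0|x0'] := ltrgtP 0 x; last by rewrite -x0' eqxx in x0.
(* For [x > 0] the phases sit in the gamma factor: its orientation sign cancels the [-1] of
   [cis_pi_shift], its [(-1) ^+ m] cancels that of [(-2) ^+ m], and [cis (pi * kappa)] cancels the
   prefactor. *)
- rewrite gtr0_sg // expr1n !mul1r cis_pi_shift exprNn.
  have cN := cis_piN R kappa; have sg2 := sqrr_sign R[i] m; rewrite expr2 in sg2.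
  rewrite !rmorphM fmorphV rmorphXn !rmorph_nat rmorphN1 /=.
  set c := cis (pi * kappa) in cN *; set c' := cis _ in cN *.
  set e := (-1) ^+ m in sg2 *.
  (* [ring] cannot know [e * e = 1] and [c' * c = 1], so these products are isolated first. *)
  transitivity ((e * e) * (c' * c) * ('C(n, m)%:R / P%:C * ((2 `^ kappa)%:C * 2 ^+ m * J%:C))).
    by rewrite sg2 cN !mul1r.
  by ring.
(* For [x < 0] the gamma factor is real; both sides carry the same [cis (pi * kappa)], and
   [Num.sg x ^+ m] matches the sign of [(-2) ^+ m]. *)
- rewrite ltr0_sg // mulN1r opprK [in RHS]exprNn.
  rewrite !rmorphM fmorphV !rmorphXn !rmorph_nat rmorphN1 /=.
  by ring.
Qed.
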